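(* There do not exist two $6\times 6$ mutually orthogonal Latin squares.
   Context: A $6\times 6$ Latin square is a $6\times 6$ matrix in which each number $1,\dots,6$ appears exactly once in every row and every column. Two such Latin squares $A,B$ are orthogonal if the set of ordered pairs $\{(A_{ij},B_{ij}):1\leq i,j\leq 6\}$ has exactly $36$ elements. *)

(* Defs.v *)
From mathcomp Require Import all_boot all_order all_algebra.

Set Implicit Arguments.
Unset Strict Implicit.
Unset Printing Implicit Defensive.

(* Entries are natural numbers; with n columns, asking that each of 1, ..., n
   occurs exactly once in a row leaves no room for any other entry. *)
Definition latin_square (n : nat) (A : 'M[nat]_n) : Prop :=
  forall k : nat, 1 <= k <= n ->
    (forall i : 'I_n, exists! j : 'I_n, A i j = k) /\
    (forall j : 'I_n, exists! i : 'I_n, A i j = k).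

(* nat * nat is not a finType, so the cardinal of the set of pairs is the
   length of the duplicate-free list of its elements. *)
Definition orthogonal_squares (n : nat) (A B : 'M[nat]_n) : Prop :=
  size (undup [seq (A ij.1 ij.2, B ij.1 ij.2) | ij : 'I_n * 'I_n]) = n ^ 2.

(* Main.v *)
(* Stinson's argument.  Two orthogonal Latin squares of order 6 form a
   transversal design: 36 blocks (the cells), four groups of six points (rows,
   columns, symbols of A, symbols of B), two points of different groups lying
   on exactly one block.  A rank computation over F_2 yields a nontrivial set
   of special points meeting every block in an even number of points; up to
   complementing it inside pairs of groups, counting forces it to have exactly
   two points in each group and no block of four special points.  Naming the
   other points of each group after the blocks through two special points then
   fixes eight blocks, and a short exhaustive search shows that these do not
   extend to a full design. *)

Require Import Defs.
From mathcomp Require Import all_boot all_order all_algebra.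
From mathcomp Require Import zify.

Set Implicit Arguments.
Unset Strict Implicit.
Unset Printing Implicit Defensive.

Import GRing.Theory.

(** * Transversal designs as orthogonal arrays *)

(** [T] is the set of blocks and [f a t] the point of group [a] on block [t]. Injectivity puts at
    most one block through two points of different groups; together with [#|T| = n * n] it puts
    exactly one. *)
Definition orthogonal_array (T : finType) (k n : nat) (f : 'I_k -> T -> 'I_n) :=
  forall a b, a != b -> injective (fun t => (f a t, f b t)).

Definition even_family (T : finType) (k n : nat) (f : 'I_k -> T -> 'I_n)
    (u : 'I_k -> 'I_n -> bool) :=
  forall t, ~~ odd (\sum_a u a (f a t)).

(** The blocks through the point [x] of group [a] correspond bijectively, through [f b], to the
    points of group [b]. *)
Lemma oa_line_sum (T : finType) (k n : nat) (f : 'I_k -> T -> 'I_n)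
    (R : Type) (idx : R) (op : Monoid.com_law idx) (F : 'I_n -> R)
    (a b : 'I_k) (x : 'I_n) :
  orthogonal_array f -> #|T| = n * n -> a != b ->
  \big[op/idx]_(t | f a t == x) F (f b t) = \big[op/idx]_y F y.
Proof.
move=> oaf cardT neq_ab.
have [|h fK hK] := inj_card_bij (oaf a b neq_ab).
  by rewrite card_prod card_ord cardT.
rewrite (reindex h); last by exists (fun t => (f a t, f b t)) => ? _.
have fh p : f a (h p) = p.1 /\ f b (h p) = p.2.
  by case: p => y z; have [] := hK (y, z).
transitivity (\big[op/idx]_(p | (p.1 == x) && true) F p.2).
  by apply: eq_big => p; rewrite ?andbT ?(fh p).1 // (fh p).2.
rewrite -(pair_big (fun i => i == x) xpredT (fun _ y => F y)) /=.
by rewrite big_pred1_eq.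
Qed.

Lemma oa_point (T : finType) (k n : nat) (f : 'I_k -> T -> 'I_n)
    (a b : 'I_k) (x y : 'I_n) :
  orthogonal_array f -> #|T| = n * n -> a != b ->
  exists t, f a t = x /\ f b t = y.
Proof.
move=> oaf cardT neq_ab.
have [|h fK hK] := inj_card_bij (oaf a b neq_ab).
  by rewrite card_prod card_ord cardT.
by exists (h (x, y)); have [] := hK (x, y).
Qed.

Lemma oa_line_size (T : finType) (k n : nat) (f : 'I_k -> T -> 'I_n)
    (a b : 'I_k) (x : 'I_n) :
  orthogonal_array f -> #|T| = n * n -> a != b ->
  \sum_(t | f a t == x) 1 = n.
Proof.
move=> oaf cardT neq_ab.
rewrite (oa_line_sum _ (fun=> 1) x oaf cardT neq_ab).
by rewrite sum_nat_const card_ord muln1.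
Qed.

(** * A dependency over F_2 between point vectors *)

Lemma exists_other (k : nat) (a : 'I_k.+2) : exists b, a != b.
Proof.
by exists (if a == ord0 then ord_max else ord0); case: (a =P ord0) => [->|/eqP].
Qed.

(* The Gram matrix of the 20 point vectors (five points in each group)
   together with the all-one vector factors through dimension 4, so by
   Sylvester's inequality 2 * rank - 36 <= 4 and these 21 vectors are
   dependent. *)
Lemma oa_relation (T : finType) (f : 'I_4 -> T -> 'I_6) :
  orthogonal_array f -> #|T| = 36 ->
  exists (w : 'I_4 -> 'I_6 -> 'F_2) (c : 'F_2),
    (forall t, \sum_a w a (f a t) = c)%R /\ exists a x y, w a x != w a y.
Proof.
(* In each group the six point vectors sum to the all-one vector. Leaving out the point [ord_max]
   removes these trivial relations. *)
move=> oaf cardT; pose I : finType := option ('I_4 * 'I_5)%type.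
pose F (r : I) (t : T) : 'F_2 :=
  if r is Some (a, x) then (f a t == lift ord_max x)%:R%R else 1%R.
pose M : 'M['F_2]_(#|I|, #|T|) := (\matrix_(r, t) F (enum_val r) (enum_val t))%R.
pose P : 'M['F_2]_(#|I|, 4) :=
  (\matrix_(r, a) if enum_val r is Some (b, _) then (b == a)%:R else 0)%R.
pose Q : 'M['F_2]_(4, #|I|) :=
  (\matrix_(a, r) if enum_val r is Some (b, _) then (a != b)%:R else 0)%R.
have two0 : (2%:R = 0 :> 'F_2)%R by apply/val_inj.
have lineF (V : nmodType) (G : 'I_6 -> V) a b x : a != b ->
    (\sum_(t | f a t == x) G (f b t) = \sum_y G y)%R.
  by move=> ?; apply: oa_line_sum.
have line1 a x : (\sum_(t | f a t == x) 1 = 0 :> 'F_2)%R.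
  have [b ab] := exists_other a.
  rewrite (lineF _ (fun=> 1%R) _ _ x ab) sumr_const card_ord.
  by rewrite (natrM _ 3 2) two0 mulr0.
have gramE r s : (\sum_t F r t * F s t =
    if r is Some (a, _) then if s is Some (b, _) then (a != b)%:R else 0 else 0)%R.
  have col1 a x : (\sum_t (f a t == x)%:R = 0 :> 'F_2)%R.
    rewrite -[RHS](line1 a x) [RHS]big_mkcond; apply: eq_bigr => t _.
    by case: eqP.
  (* Modulo 2 only points of different groups have a nonzero product, from their single common
     block: lines have 6 blocks and there are 36 blocks in all, both even, and two points of one
     group share no block. *)
  case: r s => [[a x]|] [[b y]|] /=.
  - under eq_bigr do rewrite -natrM mulnb.
    have [<- | ab] /= := eqVneq a b.
      have [-> | xy] := eqVneq x y.
        by under eq_bigr do rewrite andbb; apply: col1.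
      rewrite big1 // => t _; case: eqP => //= ->.
      by rewrite (inj_eq lift_inj) (negPf xy).
    transitivity (\sum_(t | f a t == lift ord_max x)
        (f b t == lift ord_max y)%:R : 'F_2)%R.
      by rewrite [RHS]big_mkcond; apply: eq_bigr => t _; case: eqP.
    rewrite (lineF _ (fun z => (z == lift ord_max y)%:R%R)) //.
    rewrite (bigD1 (lift ord_max y)) //= eqxx big1 ?addr0 // => z.
    by move=> /negPf ->.
  - by under eq_bigr do rewrite mulr1; apply: col1.
  - by under eq_bigr do rewrite mul1r; apply: col1.
  - under eq_bigr do rewrite mulr1.
    by rewrite sumr_const cardT (natrM _ 18 2) two0 mulr0.
have gram : (M *m M^T = P *m Q)%R.
  apply/matrixP => r s; rewrite !mxE.
  transitivity (\sum_t F (enum_val r) t * F (enum_val s) t)%R.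
    rewrite [RHS](reindex (@enum_val T T)) /=; last exact/onW_bij/enum_val_bij.
    by apply: eq_bigr => t _; rewrite !mxE.
  rewrite gramE.
  under eq_bigr do rewrite !mxE.
  case: (enum_val r) => [[a _]|]; last by rewrite big1 // => i; rewrite mul0r.
  case: (enum_val s) => [[b _]|]; last by rewrite big1 // => i; rewrite mulr0.
  rewrite (bigD1 a) //= eqxx mul1r big1 ?addr0 // => i.
  by rewrite eq_sym => /negPf ->; rewrite mul0r.
have rankM : \rank M < #|I|.
  have := mxrank_mul_min M M^T%R; rewrite gram mxrank_tr.
  have := leq_trans (mxrankM_maxl P Q) (rank_leq_col P).
  have : #|I| = 21 by rewrite card_option card_prod !card_ord.
  move: cardT; move: (\rank M) => r; move: (\rank (P *m Q)%R) => s; lia.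
have : (kermx M != 0)%R by rewrite kermx_eq0 /row_free neq_ltn rankM.
case/rowV0Pn => v /sub_kermxP vM v0.
pose w (a : 'I_4) (x : 'I_6) : 'F_2 :=
  if unlift ord_max x is Some y then v ord0 (enum_rank (Some (a, y))) else 0%R.
pose c := v ord0 (enum_rank (None : I)).
have rel t : (\sum_a w a (f a t) = - c)%R.
  apply/eqP; rewrite -addr_eq0; apply/eqP.
  have /rowP/(_ (enum_rank t)) := vM; rewrite !mxE => vMt; rewrite -[RHS]vMt.
  rewrite (reindex (@enum_rank I)) /=; last exact/onW_bij/enum_rank_bij.
  under [RHS]eq_bigr do rewrite !mxE !enum_rankK /F.
  rewrite [RHS](bigD1 None) //= mulr1 addrC; congr (_ + _)%R.
  rewrite [RHS](reindex_omap Some id) /=; last by case.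
  transitivity (\sum_a \sum_x
    v ord0 (enum_rank (Some (a, x))) * (f a t == lift ord_max x)%:R)%R; last first.
    by rewrite pair_bigA; apply: eq_big => [p | [a x] _]; rewrite ?eqxx.
  apply: eq_bigr => a _; rewrite /w; case: unliftP => [y -> | ->].
    rewrite (bigD1 y) //= eqxx mulr1 big1 ?addr0 // => z zy.
    by rewrite (inj_eq lift_inj) eq_sym (negPf zy) mulr0.
  by rewrite big1 // => z _; rewrite (negPf (neq_lift _ _)) mulr0.
exists w, (- c)%R; split=> //.
(* If [w] were constant on every group it would vanish, being 0 at [ord_max]; any block then gives
   [c = 0], so that [v = 0]. *)
case: (pickP (fun p : 'I_4 * 'I_6 => w p.1 p.2 != w p.1 ord_max)) => [[a x] /= ?|w0].
  by exists a, x, ord_max.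
have {}w0 a x : w a x = 0%R.
  by have /negbFE/eqP /= -> := w0 (a, x); rewrite /w unlift_none.
case/eqP: v0; apply/rowP => r; rewrite mxE -(enum_valK r).
case: (enum_val r) => [[a x]|].
  by have := w0 a (lift ord_max x); rewrite /w liftK.
have /card_gt0P [t _] : 0 < #|T| by rewrite cardT.
by have := rel t; rewrite big1 // => /esym/eqP; rewrite oppr_eq0 => /eqP.
Qed.

(** * Counting special points *)

Definition group_size (k n : nat) (u : 'I_k -> 'I_n -> bool) a := \sum_x u a x.

Lemma sum_except (k : nat) (F : 'I_k -> nat) a :
  \sum_(b | b != a) F b = \sum_b F b - F a.
Proof. by rewrite [in RHS](bigD1 a) //= addKn. Qed.

(** Each of the six blocks through the point [ord0] of group [a] carries, outside [a], a number of
    special points of the parity of [u a ord0]. Six equal parities cancel. *)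
Lemma even_line (T : finType) (f : 'I_4 -> T -> 'I_6)
    (u : 'I_4 -> 'I_6 -> bool) a :
  orthogonal_array f -> #|T| = 36 -> even_family f u ->
  ~~ odd (\sum_(b | b != a) group_size u b).
Proof.
move=> oaf cardT evu.
have -> : \sum_(b | b != a) group_size u b =
    \sum_(t | f a t == ord0) \sum_(b | b != a) u b (f b t).
  rewrite [RHS]exchange_big /=; apply: eq_bigr => b ab; symmetry.
  by rewrite (@oa_line_sum _ _ _ f _ _ _ (fun y => u b y : nat)) // eq_sym.
have [b ab] := exists_other a.
suff -> : odd (\sum_(t | f a t == ord0) \sum_(b | b != a) u b (f b t)) =
    odd (\sum_(t | f a t == ord0) 1 * u a ord0).
  by rewrite -big_distrl /= (oa_line_size ord0 oaf cardT ab) oddM.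
rewrite !(big_morph odd oddD (erefl _)); apply: eq_bigr => t /eqP fat.
have := evu t; rewrite (bigD1 a) //= fat mul1n oddD oddb.
by case: (u a ord0); case: odd.
Qed.

(** A block through a special point has two or four of them, hence one or three others; the product
    detects the case of four. *)
Lemma even_quadruple (v : 'I_4 -> bool) a :
  ~~ odd (\sum_b v b) -> v a -> \sum_(b | b != a) v b = 1 + 2 * \prod_b v b.
Proof.
move=> ev va; rewrite sum_except.
move: ev; rewrite !big_ord_recl !big_ord0.
have : [|| a == ord0, a == lift ord0 ord0, a == lift ord0 (lift ord0 ord0)
    | a == lift ord0 (lift ord0 (lift ord0 ord0))].
  by case: a va => [[|[|[|[|]]]] ?].
by case/or4P=> /eqP E; move: va; rewrite {}E => ->; do 3!case: (v _).
Qed.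

(* Both sides count the incidences between a point of group a and a point of
   another group lying on a common block. *)
Lemma group_size_identity (T : finType) (f : 'I_4 -> T -> 'I_6)
    (u : 'I_4 -> 'I_6 -> bool) a :
  orthogonal_array f -> #|T| = 36 -> even_family f u ->
  group_size u a * \sum_(b | b != a) group_size u b =
    6 * group_size u a + 2 * \sum_t \prod_b u b (f b t).
Proof.
move=> oaf cardT evu.
have [b ab] := exists_other a.
have split_u (F : T -> nat) :
    \sum_t u a (f a t) * F t = \sum_x u a x * \sum_(t | f a t == x) F t.
  rewrite (partition_big (f a) xpredT) //=; apply: eq_bigr => x _.
  by rewrite big_distrr; apply: eq_bigr => t /eqP ->.
transitivity (\sum_t u a (f a t) * \sum_(b | b != a) u b (f b t)).
  rewrite split_u big_distrl /=; apply: eq_bigr => x _; congr (_ * _).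
  rewrite [RHS]exchange_big /=; apply: eq_bigr => d ad; symmetry.
  by rewrite (@oa_line_sum _ _ _ f _ _ _ (fun y => u d y : nat)) // eq_sym.
have -> : 6 * group_size u a = \sum_t u a (f a t) * 1.
  rewrite split_u big_distrr /=; apply: eq_bigr => x _.
  by rewrite (oa_line_size x oaf cardT ab) mulnC.
rewrite big_distrr -big_split /=; apply: eq_bigr => t _.
case ua: (u a (f a t)); last first.
  by rewrite [X in _ = _ + 2 * X](bigD1 a) //= ua !mul0n.
by rewrite (@even_quadruple (fun d => u d (f d t)) a (evu t) ua) !mul1n.
Qed.

Definition constant_rows (k n : nat) (u : 'I_k -> 'I_n -> bool) :=
  forall a x y, u a x = u a y.

Lemma big_ord4 (R : Type) (idx : R) (op : Monoid.law idx) (F : 'I_4 -> R) :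
  \big[op/idx]_i F i =
  op (op (op (F (inord 0)) (F (inord 1))) (F (inord 2))) (F (inord 3)).
Proof.
rewrite !big_ord_recr big_ord0 Monoid.mul1m /=.
by congr (op (op (op (F _) (F _)) (F _)) (F _)); apply/val_inj; rewrite /= inordK.
Qed.

Lemma even_family_exists (T : finType) (f : 'I_4 -> T -> 'I_6) :
  orthogonal_array f -> #|T| = 36 ->
  exists u, [/\ even_family f u, ~ constant_rows u
    & forall a, a != ord_max -> group_size u a <= 3].
Proof.
move=> oaf cardT; have [w [c [sum_w [a0 [x0 [y0 w0]]]]]] := oa_relation oaf cardT.
pose b2 (z : 'F_2) := z != 0%R.
have b2D : {morph b2 : x y / (x + y)%R >-> x (+) y}.
  by move=> x y; move: x y => [[|[|?]] ?] [[|[|?]] ?].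
have b2_inj : injective b2.
  by move=> x y; move: x y => [[|[|?]] ?] [[|[|?]] ?] // _; apply/val_inj.
(* Complementing a group flips the parity on every block. Groups with more than three special points
   are complemented, and the last group is used to make the total flip equal to [c], the value of
   the relation on all blocks. *)
pose e (a : 'I_4) := 3 < \sum_x b2 (w a x).
pose e' (a : 'I_4) :=
  if a == ord_max then b2 c (+) \big[addb/false]_(b < 4 | b != ord_max) e b else e a.
pose u (a : 'I_4) x := b2 (w a x) (+) e' a.
exists u; split=> [t | const_u | a neq_a].
- rewrite (big_morph odd oddD (erefl _)).
  rewrite (eq_bigr (fun a => b2 (w a (f a t)) (+) e' a)) => [|a _]; last exact: oddb.
  rewrite big_split /= -(big_morph b2 b2D (erefl : b2 0%R = false)) sum_w.
  rewrite (bigD1 ord_max) //= /e' eqxx.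
  rewrite [X in _ (+) (_ (+) X)](eq_bigr e) => [|b /negPf -> //].
  by rewrite -addbA addbb addbF addbb.
- by case/negP: w0; apply/eqP/b2_inj; have /addIb := const_u a0 x0 y0.
- rewrite /group_size /u /e' (negPf neq_a).
  case: (ltnP 3 (\sum_x b2 (w a x))) => [gt3 | le3].
    have sum6 : \sum_x b2 (w a x) + \sum_x ~~ b2 (w a x) = 6.
      rewrite -big_split /= (eq_bigr (fun=> 1)) => [|x _]; last by case: (b2 _).
      by rewrite sum_nat_const card_ord.
    by rewrite /e gt3; under eq_bigr do rewrite addbT; lia.
  by rewrite /e ltnNge le3; under eq_bigr do rewrite addbF.
Qed.

Lemma group_sizes (T : finType) (f : 'I_4 -> T -> 'I_6)
    (u : 'I_4 -> 'I_6 -> bool) :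
  orthogonal_array f -> #|T| = 36 -> even_family f u -> ~ constant_rows u ->
  (forall a, a != ord_max -> group_size u a <= 3) ->
  (forall a, group_size u a = 2) /\ (forall t, ~ forall a, u a (f a t)).
Proof.
move=> oaf cardT evu nconst le3.
have lineE a := even_line a oaf cardT evu.
have blockE a := group_size_identity a oaf cardT evu.
pose s a := group_size u a; pose N := \sum_t \prod_b u b (f b t).
have le6 a : s a <= 6.
  by rewrite -[leqRHS]card_ord -sum1_card leq_sum // => x _; case: (u a x).
have ltmax i : i < 3 -> s (inord i) <= 3.
  move=> lti; apply: le3; rewrite -val_eqE /= inordK; last exact: leq_trans lti _.
  by rewrite neq_ltn lti.
(* The bounds leave finitely many size vectors. The parity conditions and the four incidence
   identities, which share the same [N], the number of fully special blocks, exclude all but these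
   two. *)
have sizes : [/\ s (inord 0) = 0, s (inord 1) = 0, s (inord 2) = 0 & s (inord 3) = 0]
    \/ [/\ s (inord 0) = 2, s (inord 1) = 2, s (inord 2) = 2 & s (inord 3) = 2]
       /\ N = 0.
  move: (lineE (inord 0)) (lineE (inord 1)) (lineE (inord 2)) (lineE (inord 3))
    (blockE (inord 0)) (blockE (inord 1)) (blockE (inord 2)) (blockE (inord 3))
    (ltmax 0 isT) (ltmax 1 isT) (ltmax 2 isT) (le6 (inord 3)).
  rewrite !sum_except !big_ord4 /= -/N -/(s (inord 0)) -/(s (inord 1)) -/(s (inord 2)) -/(s (inord 3)).
  move: (s _) (s _) (s _) (s _) N => {lineE blockE le3 ltmax le6} s0 s1 s2 s3 n.
  case: s0 => [|[|[|[|//]]]]; case: s1 => [|[|[|[|//]]]];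
  case: s2 => [|[|[|[|//]]]]; case: s3 => [|[|[|[|[|[|[|//]]]]]]] //= *;
  by [exfalso; lia | left | right; split=> //; lia].
have ordE (a : 'I_4) : [\/ a = inord 0, a = inord 1, a = inord 2 | a = inord 3].
  by rewrite -[a]inord_val; case: a => [[|[|[|[|//]]]] ?] /=; constructor.
case: sizes => [[s0 s1 s2 s3] | [[s0 s1 s2 s3] N0]].
  case: nconst; suff u0 a x : u a x = false by move=> a x y; rewrite !u0.
  have /eqP : s a = 0 by case: (ordE a) => ->.
  by rewrite sum_nat_eq0 => /forallP/(_ x); case: (u a x).
split=> [a | t full]; first by case: (ordE a) => ->.
move/eqP: N0; rewrite sum_nat_eq0 => /forallP/(_ t).
by rewrite big1 // => b _; rewrite full.
Qed.

(** * Naming the points of each group *)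

Lemma mem_uniq_ord (n : nat) (r : seq 'I_n) : uniq r -> size r = n -> forall i, i \in r.
Proof.
move=> uniq_r size_r i.
have /subset_cardP/(_ (subset_predT _))-> // : #|r| = #|'I_n|.
by rewrite (card_uniqP uniq_r) size_r card_ord.
Qed.

Lemma sum_uniq4 (a b c d : 'I_4) (F : 'I_4 -> nat) :
  uniq [:: a; b; c; d] -> \sum_i F i = F a + F b + F c + F d.
Proof.
move=> uniq_r; have mem_r := mem_uniq_ord uniq_r erefl.
transitivity (\sum_(i in [:: a; b; c; d]) F i).
  by apply: eq_bigl => i; rewrite mem_r.
by rewrite -big_uniq // !big_cons big_nil /= addn0 !addnA.
Qed.

Lemma special_pairs (k n : nat) (u : 'I_k -> 'I_n -> bool) :
  (forall a, group_size u a = 2) ->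
  exists p : 'I_k -> bool -> 'I_n,
    forall a, p a false != p a true /\
      forall z, u a z = (z == p a false) || (z == p a true).
Proof.
move=> size_u; apply: (@fin_all_exists _ (fun=> bool -> 'I_n) (fun a pa =>
  pa false != pa true /\ forall z, u a z = (z == pa false) || (z == pa true))) => a.
have /cards2P [x [y [xy Exy]]] : #|[set z | u a z]| == 2.
  rewrite -(size_u a) -sum1_card big_mkcond /group_size; apply/eqP/eq_bigr => z _.
  by rewrite inE; case: (u a z).
exists (fun e : bool => if e then y else x); split=> // z.
by have /setP/(_ z) := Exy; rewrite !inE.
Qed.

(** The order fixes the numbering used in the search: special points get 0 and 1, and the point
    named after the pair [x], [y] gets [2 + (2 * x + y)]. *)
Definition labels (T : Type) (p : bool -> T) (q : bool -> bool -> T) : seq T :=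
  [:: p false; p true; q false false; q false true; q true false; q true true].

(* The four blocks K x y through a special point of group a and one of group b
   have no further special point; were two of them to share a point of group c,
   the block joining that point to a special point of group d would contain an
   odd number of special points. *)
Lemma labels_uniq (T : finType) (f : 'I_4 -> T -> 'I_6)
    (u : 'I_4 -> 'I_6 -> bool) (p : 'I_4 -> bool -> 'I_6)
    (K : bool -> bool -> T) (a b c d : 'I_4) :
  orthogonal_array f -> #|T| = 36 -> even_family f u ->
  (forall t, ~ forall a, u a (f a t)) ->
  (forall a, p a false != p a true /\
    forall z, u a z = (z == p a false) || (z == p a true)) ->
  uniq [:: a; b; c; d] ->
  (forall x y, f a (K x y) = p a x /\ f b (K x y) = p b y) ->
  uniq (labels (p c) (fun x y => f c (K x y))).
Proof.
move=> oaf cardT evu nfull pP uniq4 KP.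
have up e x : u e (p e x) by rewrite (pP e).2; case: x; rewrite eqxx ?orbT.
have ev t : (u a (f a t) (+) u b (f b t)) (+) u c (f c t) = u d (f d t).
  have := evu t; rewrite (sum_uniq4 _ uniq4) !oddD !oddb.
  by case: (u a _); case: (u b _); case: (u c _); case: (u d _).
have [neq_ac neq_bc neq_cd] : [/\ a != c, b != c & c != d].
  move: uniq4; rewrite /= !inE !negb_or.
  by case: (a != c); case: (b != c); case: (c != d); rewrite ?andbF.
(* A third special point on [K x y] would by parity force a fourth, and no block is fully
   special. *)
have Kc x y : u c (f c (K x y)) = false.
  have := ev (K x y); rewrite !(KP x y).1 !(KP x y).2 !up /=.
  case uc: (u c _) => // /esym ud; case: (nfull (K x y)) => e.
  have := mem_uniq_ord uniq4 erefl e; rewrite !inE.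
  by case/or4P => /eqP ->; rewrite ?(KP x y).1 ?(KP x y).2 ?up.
have Kd x y : u d (f d (K x y)) = false.
  by rewrite -ev Kc (KP x y).1 (KP x y).2 !up.
have K_inj x y x' y' : f c (K x y) = f c (K x' y') -> x = x' /\ y = y'.
  have p_inj e : injective (p e).
    by have := (pP e).1; move=> /eqP ne [] [] // E; case: ne.
  move=> Ec; have [Ex | nx] := eqVneq x x'.
    have Ka : f a (K x y) = f a (K x' y') by rewrite !(KP _ _).1 Ex.
    have /(congr1 (f b)) : K x y = K x' y' by apply: (oaf _ _ neq_ac); congr (_, _).
    by rewrite !(KP _ _).2 => /p_inj.
  have [Ey | ny] := eqVneq y y'.
    have Kb : f b (K x y) = f b (K x' y') by rewrite !(KP _ _).2 Ey.
    have /(congr1 (f a)) : K x y = K x' y' by apply: (oaf _ _ neq_bc); congr (_, _).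
    by rewrite !(KP _ _).1 => /p_inj.
  have [t [tc td]] := oa_point (f c (K x y)) (p d true) oaf cardT neq_cd.
  have utd : u d (f d t) by rewrite td up.
  have split_bool (z z' w : bool) : z != z' -> w = z \/ w = z'.
    by case: z; case: z'; case: w; auto.
  (* By parity [t] has a special point in group [a] or [b]. As [x], [x'] and [y], [y'] exhaust the
     booleans, this point lies on [K x y] or [K x' y']; sharing also the point of group [c], [t] is
     that block, against [Kd]. *)
  have [ua | ub] : u a (f a t) \/ u b (f b t).
    have := ev t; rewrite utd tc Kc addbF.
    by case: (u a _); [left | right].
    have [w Ew] : exists w, f a t = p a w.
      by move: ua; rewrite (pP a).2 => /orP [] /eqP; [exists false | exists true].
    suff [] : t = K x y \/ t = K x' y' by move=> E; rewrite E Kd in utd.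
    case: (split_bool _ _ w nx) => Ew'; [left | right]; apply: (oaf _ _ neq_ac);
      by rewrite ?tc ?Ec Ew Ew' (KP _ _).1.
  have [w Ew] : exists w, f b t = p b w.
    by move: ub; rewrite (pP b).2 => /orP [] /eqP; [exists false | exists true].
  suff [] : t = K x y \/ t = K x' y' by move=> E; rewrite E Kd in utd.
  case: (split_bool _ _ w ny) => Ew'; [left | right]; apply: (oaf _ _ neq_bc);
    by rewrite ?tc ?Ec Ew Ew' (KP _ _).2.
have pK x x' y : (p c x == f c (K x' y)) = false.
  by apply/negP => /eqP E; have := up c x; rewrite E Kc.
have KK x y x' y' : (f c (K x y) == f c (K x' y')) = (x == x') && (y == y').
  by apply/eqP/andP => [/K_inj [-> ->] | [/eqP -> /eqP ->]].
by rewrite /= !inE !pK !KK (negPf (pP c).1).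
Qed.

(** * The exhaustive search *)

Definition quad := (nat * nat * nat * nat)%type.

(** Distinct blocks share at most one point. Equality is allowed because the search also visits the
    cells of blocks already placed. *)
Definition compatible (q q' : quad) : bool :=
  let: (a, b, c, d) := q in let: (a', b', c', d') := q' in
  (q == q') || ((a == a') + (b == b') + (c == c') + (d == d') <= 1).

Definition even_quad (q : quad) : bool :=
  let: (a, b, c, d) := q in
  ~~ odd ((a < 2) + (b < 2) + (c < 2) + (d < 2)).

(* Nested conditionals rather than [&&], whose two arguments would both be
   evaluated under call by value. *)
Fixpoint extendible (placed : seq quad) (cells : seq (nat * nat)) : bool :=
  if cells is (r, c) :: cells' then
    has (fun s => has (fun s' =>
      let q := (r, c, s, s') in
      if even_quad q then
        if all (compatible q) placed then extendible (q :: placed) cells'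
        else false
      else false) (iota 0 6)) (iota 0 6)
  else true.

(** A design provides the search with a successful branch: at each cell, choose the block of the
    design lying there. *)
Lemma extendible_complete (T : Type) (Q : T -> quad) (ts : seq T) cells :
  (forall t, even_quad (Q t)) ->
  (forall t t', compatible (Q t) (Q t')) ->
  (forall t, (Q t).1.2 < 6 /\ (Q t).2 < 6) ->
  {in cells, forall rc, exists t, (Q t).1.1 = rc} ->
  extendible (map Q ts) cells.
Proof.
move=> evQ compQ ltQ; elim: cells ts => // -[r c] cells IH ts cellQ; cbn [extendible].
have [t Qt] := cellQ (r, c) (mem_head _ _).
have QtE : (r, c, (Q t).1.2, (Q t).2) = Q t by rewrite -Qt; case: (Q t) => [[[]]].
apply/hasP; exists (Q t).1.2; first by rewrite mem_iota (ltQ t).1.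
apply/hasP; exists (Q t).2; first by rewrite mem_iota (ltQ t).2.
lazy beta zeta; rewrite QtE evQ ifT; last first.
  by rewrite all_map -(@eq_all _ predT) ?all_predT // => t' /=; rewrite compQ.
by rewrite (IH (t :: ts)) // => rc rc_in; apply: cellQ; rewrite inE rc_in orbT.
Qed.

(** The first row lists the blocks through special points of groups 0 and 1, the second those
    through special points of groups 2 and 3. *)
Definition seeds : seq quad :=
  [:: (0, 0, 2, 2); (0, 1, 3, 3); (1, 0, 4, 4); (1, 1, 5, 5);
      (2, 2, 0, 0); (3, 3, 0, 1); (4, 4, 1, 0); (5, 5, 1, 1)].

(* The two special rows come first; this order keeps the search small. *)
Definition cells : seq (nat * nat) :=
  [seq (r, c) | r <- iota 0 2, c <- iota 0 6]
  ++ [seq (r, c) | c <- iota 0 6, r <- iota 2 4].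

Lemma seeds_not_extendible : ~~ extendible seeds cells.
Proof. by vm_compute. Qed.

Lemma index_labels (T : eqType) (p : bool -> T) (q : bool -> bool -> T) :
  uniq (labels p q) ->
  (forall x, index (p x) (labels p q) = x) /\
  (forall x y, index (q x y) (labels p q) = 2 + (2 * x + y)).
Proof.
move=> uniq_l; have idx i lti := @index_uniq _ (p true) i (labels p q) lti uniq_l.
split=> [[] | [] []]; [exact: (idx 1 isT) | exact: (idx 0 isT) | exact: (idx 5 isT)
  | exact: (idx 4 isT) | exact: (idx 3 isT) | exact: (idx 2 isT)].
Qed.

Lemma no_orthogonal_array (T : finType) (f : 'I_4 -> T -> 'I_6) :
  #|T| = 36 -> ~ orthogonal_array f.
Proof.
move=> cardT oaf.
have [u [evu nconst le3]] := even_family_exists oaf cardT.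
have [size2 nfull] := group_sizes oaf cardT evu nconst le3.
have [p pP] := special_pairs size2.
pose i0 : 'I_4 := inord 0; pose i1 : 'I_4 := inord 1.
pose i2 : 'I_4 := inord 2; pose i3 : 'I_4 := inord 3.
have blocks a b : a != b -> exists K : bool -> bool -> T,
    forall x y, f a (K x y) = p a x /\ f b (K x y) = p b y.
  move=> ab.
  have [K KP] := @fin_all_exists _ (fun=> T) (fun (xy : bool * bool) t =>
    f a t = p a xy.1 /\ f b t = p b xy.2)
    (fun xy => oa_point (p a xy.1) (p b xy.2) oaf cardT ab).
  by exists (fun x y => K (x, y)) => x y; apply: (KP (x, y)).
have neq_i (i j : nat) : i < 4 -> j < 4 -> i != j -> (inord i : 'I_4) != inord j.
  by move=> lti ltj ij; rewrite -val_eqE /= !inordK.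
have [K KP] := blocks i0 i1 (neq_i 0 1 isT isT isT).
have [K' KP'] := blocks i2 i3 (neq_i 2 3 isT isT isT).
(* Points of a group are named after the blocks through special points of the two groups on the
   other side, so [K'] serves groups 0 and 1, and [K] serves groups 2 and 3. *)
pose lab (a : 'I_4) :=
  labels (p a) (fun x y => f a (if a < 2 then K' x y else K x y)).
have uniq_i i j k l : uniq [:: i; j; k; l] -> all (fun n => n < 4) [:: i; j; k; l] ->
    uniq [:: inord i : 'I_4; inord j; inord k; inord l].
  rewrite /= !inE !negb_or -!andbA => /and5P [? ? ? ? /and3P [? ? _]].
  move=> /and5P [? ? ? ? _].
  by rewrite !neq_i.
have uniq_lab a : uniq (lab a).
  rewrite /lab -[a]inord_val; case: a => [[|[|[|[|//]]]] ?] /=; rewrite inordK //=.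
  - exact: (labels_uniq oaf cardT evu nfull pP (uniq_i 2 3 0 1 isT isT) KP').
  - exact: (labels_uniq oaf cardT evu nfull pP (uniq_i 2 3 1 0 isT isT) KP').
  - exact: (labels_uniq oaf cardT evu nfull pP (uniq_i 0 1 2 3 isT isT) KP).
  - exact: (labels_uniq oaf cardT evu nfull pP (uniq_i 0 1 3 2 isT isT) KP).
have mem_lab a z : z \in lab a by apply: mem_uniq_ord.
pose g a t := index (f a t) (lab a).
have lt_g a t : g a t < 6 by rewrite [X in _ < X](erefl : 6 = size (lab a)) index_mem.
have g_inj a t t' : (g a t == g a t') = (f a t == f a t').
  apply/eqP/eqP => [E | ft]; last by rewrite /g ft.
  by rewrite -[LHS](nth_index (p a true) (mem_lab a _)) -/(g a t) E nth_index.
have g_special a t : (g a t < 2) = u a (f a t).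
  by rewrite (pP a).2 /g /lab /= ![p a _ == _]eq_sym; case: eqP => //; case: eqP.
pose Q t : quad := (g i0 t, g i1 t, g i2 t, g i3 t).
have := seeds_not_extendible.
(* Once the seeds are recognized as eight blocks of the relabelled design, the design itself extends
   them, contradicting the search. *)
suff -> : seeds = map Q [:: K false false; K false true; K true false; K true true;
    K' false false; K' false true; K' true false; K' true true].
  case/negP; apply: extendible_complete => [t | t t' | t | [r c] rc_in].
  - by rewrite /= !g_special; have := evu t; rewrite big_ord4.
  - have coord2 a b : a != b -> f a t = f a t' -> f b t = f b t' -> t = t'.
      by move=> ab Ea Eb; apply: (oaf a b ab); rewrite Ea Eb.
    rewrite /compatible /= !g_inj.
    have [<- | /eqP neq_t] := t =P t'; first by rewrite eqxx.
    have coord2b a b : a != b -> (f a t == f a t') && (f b t == f b t') = false.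
      move=> ab; apply/negP => /andP [/eqP Ea /eqP Eb].
      by case/eqP: neq_t; apply: coord2 ab Ea Eb.
    have := coord2b i0 i1 (neq_i 0 1 isT isT isT).
    have := coord2b i0 i2 (neq_i 0 2 isT isT isT).
    have := coord2b i0 i3 (neq_i 0 3 isT isT isT).
    have := coord2b i1 i2 (neq_i 1 2 isT isT isT).
    have := coord2b i1 i3 (neq_i 1 3 isT isT isT).
    have := coord2b i2 i3 (neq_i 2 3 isT isT isT).
    by do 4!case: (f _ t == _); rewrite //= orbT.
  - by split; apply: lt_g.
  - have [ltr ltc] : r < 6 /\ c < 6.
      have /allP/(_ _ rc_in)/andP [] // : all (fun rc => (rc.1 < 6) && (rc.2 < 6)) cells.
      by [].
    have [t [tr tc]] := oa_point (nth (p i0 true) (lab i0) r)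
      (nth (p i1 true) (lab i1) c) oaf cardT (neq_i 0 1 isT isT isT).
    by exists t; rewrite /Q /= /g tr tc !index_uniq.
have gp a t x : f a t = p a x -> g a t = x.
  by rewrite /g => ->; apply: (index_labels (uniq_lab a)).1.
have gl (a : 'I_4) x y : g a (if a < 2 then K' x y else K x y) = 2 + (2 * x + y).
  exact: (index_labels (uniq_lab a)).2.
have gK (a : 'I_4) x y : ~~ (a < 2) -> g a (K x y) = 2 + (2 * x + y).
  by have := gl a x y; case: (a < 2).
have gK' (a : 'I_4) x y : a < 2 -> g a (K' x y) = 2 + (2 * x + y).
  by have := gl a x y; case: (a < 2).
have QK x y : Q (K x y) = (x : nat, y : nat, 2 + (2 * x + y), 2 + (2 * x + y)).
  by rewrite /Q (gp _ _ _ (KP x y).1) (gp _ _ _ (KP x y).2) !gK ?inordK.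
have QK' x y : Q (K' x y) = (2 + (2 * x + y), 2 + (2 * x + y), x : nat, y : nat).
  by rewrite /Q (gp _ _ _ (KP' x y).1) (gp _ _ _ (KP' x y).2) !gK' ?inordK.
by rewrite /= !QK !QK'.
Qed.

(** * From Latin squares to an orthogonal array *)

(** The values 1 to [n] occur in row [i] at [n] distinct columns, hence at all of them. *)
Lemma latin_square_range (n : nat) (A : 'M[nat]_n) i j :
  latin_square A -> 1 <= A i j <= n.
Proof.
move=> latA.
have row_value (k : 'I_n) : exists j', A i j' = k.+1.
  by have [/(_ i) [j' [Aj' _]] _] := latA k.+1 (ltn_ord k); exists j'.
have [g gP] := fin_all_exists row_value.
have g_inj : injective g.
  by move=> k k' E; apply/val_inj/succn_inj; rewrite -!gP E.
by have [h _ hK] := injF_bij g_inj; rewrite -(hK j) gP ltn_ord.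
Qed.

Theorem corollary4p11 :
  ~ exists A B : 'M[nat]_6,
      [/\ latin_square A, latin_square B & orthogonal_squares A B].
Proof.
case=> A [B [latA latB orthAB]].
pose f (a : 'I_4) (t : 'I_6 * 'I_6) : 'I_6 :=
  match val a with
  | 0 => t.1
  | 1 => t.2
  | 2 => inord (A t.1 t.2).-1
  | _ => inord (B t.1 t.2).-1
  end.
have inord_pred (C : 'M[nat]_6) i j i' j' : latin_square C ->
    inord (C i j).-1 = inord (C i' j').-1 :> 'I_6 -> C i j = C i' j'.
  move=> latC /(congr1 val) /=.
  by have := latin_square_range i j latC; have := latin_square_range i' j' latC;
    move=> ? ?; rewrite !inordK; lia.
have row_inj (C : 'M[nat]_6) i j j' : latin_square C ->
    inord (C i j).-1 = inord (C i j').-1 :> 'I_6 -> j = j'.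
  move=> latC /(inord_pred _ _ _ _ _ latC) E.
  have [/(_ i) [l [_ lP]] _] := latC _ (latin_square_range i j latC).
  by rewrite -(lP j) // -(lP j').
have col_inj (C : 'M[nat]_6) i i' j : latin_square C ->
    inord (C i j).-1 = inord (C i' j).-1 :> 'I_6 -> i = i'.
  move=> latC /(inord_pred _ _ _ _ _ latC) E.
  have [_ /(_ j) [l [_ lP]]] := latC _ (latin_square_range i j latC).
  by rewrite -(lP i) // -(lP i').
(* The list of pairs has 36 entries and 36 distinct ones, so it has no repetition. *)
have pair_inj : injective (fun t : 'I_6 * 'I_6 => (A t.1 t.2, B t.1 t.2)).
  apply/injectiveP; rewrite /injectiveb /dinjectiveb -[uniq _]negbK -ltn_size_undup.
  by rewrite [X in X < _]orthAB size_map -cardE card_prod !card_ord.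
apply: (@no_orthogonal_array _ f); first by rewrite card_prod !card_ord.
have oa_of_lt : (forall a b : 'I_4, a < b -> injective (fun t => (f a t, f b t))) ->
    orthogonal_array f.
  move=> H a b; rewrite neq_ltn => /orP [/H // | /H inj_ba] t t' [Ea Eb].
  by apply: inj_ba; rewrite Ea Eb.
(* The six pairs of groups: cells have two coordinates, rows and columns do not repeat a symbol in
   [A] or [B], and the last pair is orthogonality. *)
apply: oa_of_lt => -[[|[|[|[|//]]]] ?] -[[|[|[|[|//]]]] ?] //= _ [i j] [i' j'];
  rewrite /f /= => -[].
- by move=> -> ->.
- by move=> -> /(row_inj _ _ _ _ latA) ->.
- by move=> -> /(row_inj _ _ _ _ latB) ->.
- by move=> -> /(col_inj _ _ _ _ latA) ->.
- by move=> -> /(col_inj _ _ _ _ latB) ->.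
- move=> /(inord_pred _ _ _ _ _ latA) EA /(inord_pred _ _ _ _ _ latB) EB.
  by apply: pair_inj; rewrite /= EA EB.
Qed.
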